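(* Let $\mathbf{T}_\varphi=(c_{i-j})_{i,j=0}^\infty$ be a Toeplitz HPD matrix associated with $\varphi\in L^2(\mathbb{T})$ with $\operatorname{ess\,inf}\varphi(z)>0$. Then the matrix $\mathbf{A}_\varphi=\overline{\mathbf{B}}\mathbf{B}^{t}$, where $\mathbf{B}$ is the transition matrix associated with $\mathbf{T}_\varphi$, exists and is a classical inverse matrix of $\mathbf{T}_\varphi$, i.e. $\mathbf{A}_\varphi\mathbf{T}_\varphi=\mathbf{T}_\varphi\mathbf{A}_\varphi=\mathbf{I}$.
   Context: $\mathbb{T}$ is the unit circle with Lebesgue measure. The Toeplitz matrix associated with $\varphi$ is $\mathbf{T}_\varphi=(c_{i-j})_{i,j=0}^\infty$ with $c_n=\frac1{2\pi}\int_0^{2\pi}\varphi(e^{i\theta})e^{-in\theta}\,d\theta$, $n\in\mathbb{Z}$. An infinite complex matrix $\mathbf{M}=(m_{i,j})_{i,j=0}^\infty$ is HPD if $m_{i,j}=\overline{m_{j,i}}$ for all $i,j$ and $\det(m_{i,j})_{i,j=0}^n>0$ for all $n\ge0$. It defines an inner product on $\mathbb{C}[z]$ by $\langle z^i,z^j\rangle=m_{i,j}$ (linear in the first variable), with orthonormal polynomials $P_n(z)=\sum_{k=0}^n b_{k,n}z^k$, $b_{n,n}>0$, $\langle P_n,P_m\rangle=\delta_{n,m}$; the transition matrix is the upper triangular matrix $\mathbf{B}=(b_{k,n})_{k,n=0}^\infty$ ($b_{k,n}=0$ for $k>n$). $\overline{\mathbf{B}}\mathbf{B}^t$ exists if all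 series $\sum_{k\ge\max\{i,j\}}\overline{b_{i,k}}\,b_{j,k}$ (its entries) converge. Products of infinite matrices are formal products (convergent series of entries); $\mathbf{I}$ is the infinite identity matrix. *)

(* Defs.v *)
From HB Require Import structures.
From mathcomp Require Import all_boot all_order all_algebra.
From mathcomp Require Import complex.
From mathcomp Require Import all_classical all_reals all_analysis.
From mathcomp Require Import ess_sup_inf.

Set Implicit Arguments.
Unset Strict Implicit.
Unset Printing Implicit Defensive.

Import Order.TTheory GRing.Theory Num.Theory numFieldNormedType.Exports.

Local Open Scope classical_set_scope.
Local Open Scope complex_scope.
Local Open Scope ring_scope.

Section InfiniteMatrices.
Variable R : realType.

Definition infmx := nat -> nat -> R[i].

Implicit Types M N : infmx.

Definition infmx_id : infmx := fun i j => (i == j)%:R.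

Definition infmx_tr M : infmx := fun i j => M j i.

Definition infmx_conj M : infmx := fun i j => (M i j)^*.

(* R[i]^o is R[i] with its norm topology. *)
Definition infmx_mul_series M N (i j : nat) : nat -> R[i]^o :=
  series (fun k => (M i k * N k j : R[i]^o)).

Definition infmx_mul_exists M N : Prop :=
  forall i j, cvgn (infmx_mul_series M N i j).

(* Meaningful only under [infmx_mul_exists M N]: [limn] is total. *)
Definition infmx_mul M N : infmx := fun i j => limn (infmx_mul_series M N i j).

Definition classical_inverse M N : Prop :=
  [/\ infmx_mul_exists N M, infmx_mul N M =2 infmx_id,
      infmx_mul_exists M N & infmx_mul M N =2 infmx_id].

(* In R[i], [0 < z] means that z is real and positive. *)
Definition HPD M : Prop :=
  (forall i j, M i j = (M j i)^*) /\
  (forall n : nat, 0 < \det (\matrix_(i < n.+1, j < n.+1) M i j)).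

(* The sesquilinear form on polynomials with <z^i, z^j> = M i j, linear in its
   first argument. *)
Definition poly_form M (p q : {poly R[i]}) : R[i] :=
  \sum_(i < size p) \sum_(j < size q) p`_i * (q`_j)^* * M i j.

Definition orthonormal_polys M (P : nat -> {poly R[i]}) : Prop :=
  [/\ forall n, (size (P n) <= n.+1)%N,
      forall n, 0 < (P n)`_n
    & forall n m, poly_form M (P n) (P m) = (n == m)%:R].

(* B k n is the coefficient of z^k in P_n. *)
Definition is_transition_matrix M (B : infmx) : Prop :=
  exists2 P, orthonormal_polys M P & forall k n, B k n = (P n)`_k.

End InfiniteMatrices.

Section Toeplitz.
Variable R : realType.

(* e^{it} *)
Definition cis (t : R) : R[i] := cos t +i* sin t.

(* Functions on the unit circle are functions on R[i], of which only the values
   at the points [cis t] matter; the circle is parametrized by [0, 2 pi]. *)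
Implicit Type phi : R[i] -> R[i].

Definition circle_measure : {measure set (measurableTypeR R) -> \bar R} :=
  mrestr (@lebesgue_measure R) (measurable_itv `[0, 2 * pi]).

Definition L2_circle phi : Prop :=
  [/\ measurable_fun `[0, 2 * pi] (fun t => complex.Re (phi (cis t))),
      measurable_fun `[0, 2 * pi] (fun t => complex.Im (phi (cis t)))
    & (\int[@lebesgue_measure R]_(t in `[0%R, (2 * pi)%R])
         ((complex.Re (phi (cis t)) ^+ 2 + complex.Im (phi (cis t)) ^+ 2)%R)%:E
       < +oo)%E].

(* The essential infimum only makes sense for phi real almost everywhere.  This
   is the case as soon as the Toeplitz matrix of phi in L^2 is Hermitian, and
   then phi and Re phi agree almost everywhere. *)
Definition ess_inf_circle phi : \bar R :=
  ess_inf circle_measure (fun t => (complex.Re (phi (cis t)))%:E).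

Definition complex_integral (D : set R) (f : R -> R[i]) : R[i] :=
  (\int[@lebesgue_measure R]_(t in D) complex.Re (f t)) +i*
  (\int[@lebesgue_measure R]_(t in D) complex.Im (f t)).

Definition fourier_coef phi (n : int) : R[i] :=
  ((2 * pi)^-1)%:C *
  complex_integral `[0, 2 * pi] (fun t => phi (cis t) * cis (- (n%:~R * t))).

Definition toeplitz phi : infmx R :=
  fun i j => fourier_coef phi (i%:Z - j%:Z).

End Toeplitz.

(* Main.v *)
Require Import Defs.
From mathcomp Require Import all_boot all_order all_algebra.
From mathcomp Require Import complex.
From mathcomp Require Import all_classical all_reals all_analysis.
From mathcomp Require Import ess_sup_inf measurable_realfun ring lra.

Set Implicit Arguments.
Unset Strict Implicit.
Unset Printing Implicit Defensive.

Import Order.TTheory GRing.Theory Num.Theory numFieldNormedType.Exports.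

(** Write [<x, y>] for the form of the Toeplitz matrix [T] on finitely supported
sequences and [lam] for a positive lower bound of [Re phi].

Orthonormality of the polynomials [P_n] says that the finite sections of [T]
and of the upper triangular matrix [B] satisfy [B^t T conj B = I], hence that
[A_N = conj B_N B_N^t] is the inverse of the [N]-th section of [T]
([section_mul_partial_inverse], [partial_inverse_mul_section]).  Its entries are
the partial sums of the series that define [A = conj B B^t], so the problem is
to let [N] tend to infinity in [T_N A_N = A_N T_N = I].

Two facts about [phi] make this possible.  Since [Re phi >= lam], the real part
of [<y, y>] is at least [lam |y|^2] ([toeplitz_form_coercive]).  So the norms of
the [A_N] are bounded: the rows of [B] have squared norm at most [1 / lam],
which makes the series for [A] converge by Cauchy and Schwarz, and the rows and
columns of [A_N] are bounded in [l^2] uniformly in [N]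
([partial_inverse_bounds]).  Since [phi] is square-integrable, Bessel's inequality
shows that the rows and columns of [T] are in [l^2] ([Bessel]).

A bounded sequence of [l^2] that converges entrywise converges weakly
([weak_limit_series]); pairing it with a row or a column of [T] passes to the
limit and gives [T A = A T = I] ([transition_inverse]). *)

(** * Squared moduli *)

Section SquaredModulus.
Context {R : realType}.
Local Open Scope complex_scope.
Local Open Scope ring_scope.
Implicit Types z l : R[i].

Definition normsq z : R := complex.Re z ^+ 2 + complex.Im z ^+ 2.

Lemma normsq_ge0 z : 0 <= normsq z.
Proof. by rewrite addr_ge0 // sqr_ge0. Qed.

Lemma normsqE z : (normsq z)%:C = z * z^*.
Proof. by case: z => a b; rewrite /normsq; simpc; congr (_ +i* _); ring. Qed.

Lemma normsqJ z : normsq z^* = normsq z.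
Proof. by case: z => a b; rewrite /normsq /= sqrrN. Qed.

Lemma normsqM z l : normsq (z * l) = normsq z * normsq l.
Proof. by case: z l => a b [c d]; rewrite /normsq /=; ring. Qed.

(** The defect is the squared modulus of [z - l] (parallelogram law). *)
Lemma normsqD_le z l : normsq (z + l) <= 2 * (normsq z + normsq l).
Proof.
case: z l => a b [c d]; rewrite /normsq /= -subr_ge0.
have := addr_ge0 (sqr_ge0 (a - c)) (sqr_ge0 (b - d)).
by apply: etrans; congr (0 <= _); ring.
Qed.

End SquaredModulus.

(** * Complex integrals over the circle *)

Section ComplexIntegral.
Context {R : realType}.
Local Open Scope classical_set_scope.
Local Open Scope complex_scope.
Local Open Scope ring_scope.
Implicit Types (f g : R -> R[i]) (c z : R[i]) (m n : int) (t : R).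

Lemma cisD s t : cis (s + t) = cis s * cis t.
Proof. by rewrite /cis cosD sinD; simpc; congr (_ +i* _); ring. Qed.

Lemma cisN t : cis (- t) = (cis t)^*.
Proof. by rewrite /cis cosN sinN. Qed.

Local Notation mu := (@lebesgue_measure R).
Local Notation D := (`[0, 2 * pi]%classic : set R).

(** Real and imaginary parts are integrated separately, so that each of the two
real integrals has to make sense. *)
Definition cintegrable f :=
  mu.-integrable D (EFin \o (fun t => complex.Re (f t))) /\
  mu.-integrable D (EFin \o (fun t => complex.Im (f t))).

Local Notation cint := (complex_integral D).

Lemma measurable_circle : measurable (D : set (measurableTypeR R)).
Proof. exact: measurable_itv. Qed.
#[local] Hint Resolve measurable_circle : core.

Lemma integrable_lincomb (a b : R) (u v : R -> R) :
  mu.-integrable D (EFin \o u) -> mu.-integrable D (EFin \o v) ->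
  mu.-integrable D (EFin \o (fun t => a * u t + b * v t)).
Proof.
move=> iu iv; apply: eq_integrable (integrableD _ (integrableZl _ a iu)
  (integrableZl _ b iv)) => //.
Qed.

Lemma Rintegral_lincomb (a b : R) (u v : R -> R) :
  mu.-integrable D (EFin \o u) -> mu.-integrable D (EFin \o v) ->
  \int[mu]_(t in D) (a * u t + b * v t) =
  a * \int[mu]_(t in D) u t + b * \int[mu]_(t in D) v t.
Proof.
move=> iu iv; rewrite RintegralD //; first by rewrite !RintegralZl.
  by apply: eq_integrable (integrableZl _ a iu).
by apply: eq_integrable (integrableZl _ b iv).
Qed.

Lemma cintegrableD f g : cintegrable f -> cintegrable g ->
  cintegrable (fun t => f t + g t).
Proof.
move=> [rf jf] [rg jg]; split.
  apply: eq_integrable (integrable_lincomb 1 1 rf rg) => // t _.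
  by rewrite /= !mul1r; case: (f t) (g t) => ? ? [].
apply: eq_integrable (integrable_lincomb 1 1 jf jg) => // t _.
by rewrite /= !mul1r; case: (f t) (g t) => ? ? [].
Qed.

Lemma cintegrableZ c f : cintegrable f -> cintegrable (fun t => c * f t).
Proof.
case: c => a b [rf jf]; split.
  apply: eq_integrable (integrable_lincomb a (- b) rf jf) => // t _.
  by rewrite /=; case: (f t) => ? ? /=; congr EFin; ring.
apply: eq_integrable (integrable_lincomb a b jf rf) => // t _.
by rewrite /=; case: (f t) => ? ? /=; congr EFin; ring.
Qed.

Lemma eq_cint f g : f =1 g -> cint f = cint g.
Proof. by move=> /funext ->. Qed.

Lemma cintD f g : cintegrable f -> cintegrable g ->
  cint (fun t => f t + g t) = cint f + cint g.
Proof.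
move=> [rf jf] [rg jg]; rewrite /complex_integral; simpc; congr (_ +i* _).
  rewrite -RintegralD //; apply: eq_Rintegral => t _.
  by case: (f t) (g t) => ? ? [].
rewrite -RintegralD //; apply: eq_Rintegral => t _.
by case: (f t) (g t) => ? ? [].
Qed.

Lemma cintZ c f : cintegrable f -> cint (fun t => c * f t) = c * cint f.
Proof.
case: c => a b [rf jf]; rewrite /complex_integral; simpc; congr (_ +i* _).
  rewrite -mulNr -Rintegral_lincomb //; apply: eq_Rintegral => t _.
  by case: (f t) => ? ? /=; ring.
rewrite -Rintegral_lincomb //; apply: eq_Rintegral => t _.
by case: (f t) => ? ? /=; ring.
Qed.

Lemma cintegrable_cint0 : cintegrable (fun=> 0) /\ cint (fun=> 0) = 0.
Proof.
split; first by split; exact: integrable0.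
by rewrite /complex_integral /= Rintegral_cst // mul0r.
Qed.

(** Integrability and the value of the integral go together: the induction that
splits off one summand needs the integrability of the remaining sum. *)
Lemma cint_sum_integrable (I : Type) (s : seq I) (c : I -> R[i])
    (f : I -> R -> R[i]) :
  (forall k, cintegrable (f k)) ->
  cintegrable (fun t => \sum_(k <- s) c k * f k t) /\
  cint (fun t => \sum_(k <- s) c k * f k t) = \sum_(k <- s) c k * cint (f k).
Proof.
move=> fi; elim: s => [|k s [IHi IHe]].
  have -> : (fun t => \sum_(k <- [::]) c k * f k t) = (fun=> 0).
    by apply/funext => t; rewrite big_nil.
  by rewrite big_nil; exact: cintegrable_cint0.
have -> : (fun t => \sum_(k <- k :: s) c k * f k t) =
    (fun t => c k * f k t + \sum_(k <- s) c k * f k t).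
  by apply/funext => t; rewrite big_cons.
have ki := cintegrableZ (c k) (fi k).
by split; [exact: cintegrableD | rewrite big_cons cintD // cintZ // IHe].
Qed.

Lemma continuous_integrable (u : R -> R) :
  continuous u -> mu.-integrable D (EFin \o u).
Proof.
move=> cu; apply: (@continuous_compact_integrable R u).
  exact: segment_compact.
exact: continuous_subspaceT.
Qed.

Lemma continuous_cosZ (a : R) : continuous (fun t => cos (a * t)).
Proof.
move=> t; apply: (@continuous_comp _ _ _ ( *%R a) cos).
  exact: mulrl_continuous.
exact: continuous_cos.
Qed.

Lemma continuous_sinZ (a : R) : continuous (fun t => sin (a * t)).
Proof.
move=> t; apply: (@continuous_comp _ _ _ ( *%R a) sin).
  exact: mulrl_continuous.
exact: continuous_sin.
Qed.

Lemma cintegrable_cis n : cintegrable (fun t => cis (n%:~R * t)).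
Proof.
split; apply: continuous_integrable; first exact: continuous_cosZ.
exact: continuous_sinZ.
Qed.

Lemma Rintegral_derive (F f : R -> R) :
  (forall t, is_derive t 1 F (f t)) -> continuous f ->
  \int[mu]_(t in D) f t = F (2 * pi) - F 0.
Proof.
move=> dF cf; rewrite /Rintegral (@continuous_FTC2 _ f F) //.
- by rewrite mulr_gt0 ?pi_gt0.
- exact: continuous_subspaceT.
- have cF : continuous F.
    move=> t; apply/differentiable_continuous/derivable1_diffP.
    by have [] := dF t.
  split; first by move=> t _; have [] := dF t.
    by apply: cvg_at_right_filter; exact: cF.
  by apply: cvg_at_left_filter; exact: cF.
- by move=> t _; rewrite derive1E; have [_ ->] := dF t.
Qed.

Lemma cos_sin_period n : cos (n%:~R * (2 * pi)) = 1 :> R /\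
                         sin (n%:~R * (2 * pi)) = 0 :> R.
Proof.
have h (k : nat) : cos (k%:R * (2 * pi)) = 1 :> R /\
    sin (k%:R * (2 * pi)) = 0 :> R.
  elim: k => [|k [IHc IHs]]; first by rewrite mul0r cos0 sin0.
  rewrite -natr1 mulrDl mul1r cosD sinD IHc IHs mul1r !mul0r mul1r.
  by rewrite mulr_natl cos2pi sin2pi subr0 addr0.
case: n => k; first exact: h.
rewrite NegzE mulrNz mulNr cosN sinN; have [-> ->] := h k.+1.
by rewrite oppr0.
Qed.

(** Orthogonality of the characters: for [n != 0] the primitive
[(sin (n t) - i cos (n t)) / n] is [2 pi]-periodic. *)
Lemma cint_cis n :
  cint (fun t => cis (n%:~R * t)) = if n == 0 then (2 * pi)%:C else 0.
Proof.
have [->|n0] := eqVneq n 0.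
  rewrite /complex_integral /cis /=; congr (_ +i* _).
    under eq_Rintegral => t _ do rewrite mul0r cos0.
    rewrite Rintegral_cst // mul1r.
    have /= -> := @lebesgue_measure_itv R `[0, 2 * pi].
    by rewrite lte_fin mulr_gt0 ?pi_gt0 //= subr0.
  under eq_Rintegral => t _ do rewrite mul0r sin0.
  by rewrite Rintegral_cst // mul0r.
have nR : n%:~R != 0 :> R by rewrite intr_eq0.
have [c1 s0] := cos_sin_period n.
have dsin t : is_derive t 1 (fun x => n%:~R^-1 * sin (n%:~R * x))
    (cos (n%:~R * t)) by apply: is_derive_eq; rewrite /GRing.scale /=; field.
have dcos t : is_derive t 1 (fun x => - n%:~R^-1 * cos (n%:~R * x))
    (sin (n%:~R * t)) by apply: is_derive_eq; rewrite /GRing.scale /=; field.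
rewrite /complex_integral /cis /=; congr (_ +i* _).
  rewrite (Rintegral_derive dsin (@continuous_cosZ _)).
  by rewrite s0 mulr0 mulr0 sin0 mulr0 subr0.
rewrite (Rintegral_derive dcos (@continuous_sinZ _)).
by rewrite c1 mulr0 cos0 subrr.
Qed.

Lemma cint_real (u : R -> R) :
  cint (fun t => (u t)%:C) = (\int[mu]_(t in D) u t)%:C.
Proof. by rewrite /complex_integral /= Rintegral_cst // mul0r. Qed.

Lemma integrable_bounded_mul (u v : R -> R) :
  mu.-integrable D (EFin \o u) -> continuous v -> (forall t, `|v t| <= 1) ->
  mu.-integrable D (EFin \o (fun t => u t * v t)).
Proof.
move=> iu cv v1; have mu_ := measurable_int _ iu.
apply: le_integrable iu => //.
  apply/measurable_EFinP; apply: measurable_funM; first exact/measurable_EFinP.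
  apply: measurable_funTS; exact: continuous_measurable_fun.
move=> t _; rewrite /= lee_fin normrM -[leRHS]mulr1.
by rewrite ler_wpM2l.
Qed.

Lemma cintegrable_mul_cis f n : cintegrable f ->
  cintegrable (fun t => f t * cis (n%:~R * t)).
Proof.
move=> [rf jf].
have cc := @continuous_cosZ n%:~R; have cs := @continuous_sinZ n%:~R.
have lc t : `|cos (n%:~R * t)| <= 1 :> R by rewrite ler_norml cos_geN1 cos_le1.
have ls t : `|sin (n%:~R * t)| <= 1 :> R by rewrite ler_norml sin_geN1 sin_le1.
split.
  apply: eq_integrable (integrable_lincomb 1 (- 1)
    (integrable_bounded_mul rf cc lc) (integrable_bounded_mul jf cs ls)) => //.
  by move=> t _ /=; case: (f t) => ? ? /=; congr EFin; ring.
apply: eq_integrable (integrable_lincomb 1 1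
  (integrable_bounded_mul rf cs ls) (integrable_bounded_mul jf cc lc)) => //.
by move=> t _ /=; case: (f t) => ? ? /=; congr EFin; ring.
Qed.

End ComplexIntegral.

(** * Trigonometric polynomials *)

Section TrigonometricPolynomials.
Context {R : realType} {I : finType}.
Variables (c : I -> R[i]) (n : I -> int).
Local Open Scope classical_set_scope.
Local Open Scope complex_scope.
Local Open Scope ring_scope.
Local Notation mu := (@lebesgue_measure R).
Local Notation D := (`[0, 2 * pi]%classic : set R).
Local Notation cint := (complex_integral D).

Definition trigpoly (t : R) : R[i] := \sum_k c k * cis ((n k)%:~R * t).

Lemma normsq_trigpoly t : (normsq (trigpoly t))%:C =
  \sum_(p : I * I) c p.1 * (c p.2)^* * cis ((n p.1 - n p.2)%:~R * t).
Proof.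
rewrite normsqE /trigpoly rmorph_sum big_distrlr /= pair_big /=.
apply: eq_bigr => -[k l] _ /=.
by rewrite rmorphM /= -cisN rmorphB mulrBl cisD; ring.
Qed.

Lemma cintegrable_normsq_trigpoly :
  cintegrable (fun t => (normsq (trigpoly t))%:C).
Proof.
under [X in cintegrable X]funext do rewrite normsq_trigpoly.
by apply cint_sum_integrable => p; exact: cintegrable_cis.
Qed.

(** Parseval's identity: when the double sum for the squared modulus is
integrated, orthogonality kills the off-diagonal terms. *)
Lemma Rintegral_normsq_trigpoly : injective n ->
  \int[mu]_(t in D) normsq (trigpoly t) = 2 * pi * \sum_k normsq (c k).
Proof.
move=> inj; apply: complexI; rewrite -cint_real.
under [X in cint X]funext do rewrite normsq_trigpoly.
rewrite (proj2 (cint_sum_integrable _ _ _)); last first.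
  by move=> p; exact: cintegrable_cis.
rewrite rmorphM rmorph_sum -(pair_big xpredT xpredT
  (fun k l => c k * (c l)^* * cint (fun t => cis ((n k - n l)%:~R * t)))) /=.
rewrite mulr_sumr; apply: eq_bigr => k _.
rewrite (bigD1 k) //= big1 ?addr0 => [|l lk]; rewrite cint_cis.
  by rewrite subrr eqxx -normsqE mulrC.
by rewrite subr_eq0 (inj_eq inj) eq_sym (negbTE lk) mulr0.
Qed.

End TrigonometricPolynomials.

(** * Bessel's inequality and coercivity of Toeplitz forms *)

Section Symbol.
Context {R : realType} (phi : R[i] -> R[i]).
Local Open Scope classical_set_scope.
Local Open Scope complex_scope.
Local Open Scope ring_scope.
Hypothesis phiL2 : L2_circle phi.
Local Notation mu := (@lebesgue_measure R).
Local Notation D := (`[0, 2 * pi]%classic : set R).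
Local Notation cint := (complex_integral D).
Let f (t : R) := phi (cis t).

Lemma integrable_normsq_symbol :
  mu.-integrable D (EFin \o (fun t => normsq (f t))).
Proof.
have [mre mim fin] := phiL2; apply/integrableP; split.
  by apply/measurable_EFinP; apply: measurable_funD; exact: measurable_funX.
by under eq_integral => t _ do rewrite /= ger0_norm ?normsq_ge0 //.
Qed.

(** The circle has finite measure, so that square-integrable functions are
integrable, by [`|x| <= 1 + x ^+ 2]. *)
Lemma cintegrable_symbol : cintegrable f.
Proof.
have [mre mim _] := phiL2.
have i1 : mu.-integrable D (EFin \o (fun t => 1 * 1 + 1 * normsq (f t))).
  apply: integrable_lincomb integrable_normsq_symbol.
  by apply: continuous_integrable => t; exact: cvg_cst.
by split; apply: le_integrable i1; try exact: measurable_circle;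
  try exact/measurable_EFinP; move=> t _;
  rewrite /= lee_fin !mul1r ler_norml /normsq;
  (rewrite (@ger0_norm _ (1 + _)); last by rewrite addr_ge0 // normsq_ge0);
  apply/andP; split; nra.
Qed.

Lemma cint_symbol_cis (n : int) :
  cint (fun t => f t * cis (n%:~R * t)) = (2 * pi)%:C * fourier_coef phi (- n).
Proof.
rewrite /fourier_coef mulrA -rmorphM divff /= ?mul1r; last first.
  by rewrite mulf_neq0 // gt_eqF // pi_gt0.
by apply: eq_cint => t; rewrite /f rmorphN mulNr opprK.
Qed.

(** Let [s] be the trigonometric polynomial built from the Fourier coefficients of
[f] at the frequencies [n k].  Integrating [2 Re (f * conj s) <= |f|^2 + |s|^2]
gives the bound, because [f * conj s] and [|s|^2] have the same integral,
namely [2 pi] times the sum to be estimated. *)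
Lemma Bessel (I : finType) (n : I -> int) : injective n ->
  \sum_k normsq (fourier_coef phi (n k)) <=
  (2 * pi)^-1 * \int[mu]_(t in D) normsq (f t).
Proof.
move=> inj; set c := fun k => fourier_coef phi (n k); set S := \sum_k _.
have pi2 : 0 < 2 * pi :> R by rewrite mulr_gt0 ?pi_gt0.
rewrite ler_pdivlMl //.
have iq := integrable_normsq_symbol.
have is_ : mu.-integrable D (EFin \o (fun t => normsq (trigpoly c n t))).
  exact: (cintegrable_normsq_trigpoly c n).1.
pose g t := f t * (trigpoly c n t)^*.
have gE t : g t = \sum_k (c k)^* * (f t * cis ((- n k)%:~R * t)).
  rewrite /g /trigpoly rmorph_sum mulr_sumr; apply: eq_bigr => k _.
  by rewrite rmorphM /= -cisN rmorphN mulNr; ring.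
have [ig cg] : cintegrable g /\ cint g = (2 * pi * S)%:C.
  rewrite (funext gE).
  have fc k := cintegrable_mul_cis (- n k) cintegrable_symbol.
  have [? ->] := cint_sum_integrable (index_enum I) (fun k => (c k)^*) fc.
  split=> //; rewrite rmorphM rmorph_sum mulr_sumr.
  apply: eq_bigr => k _; rewrite cint_symbol_cis opprK.
  by have /= -> := normsqE (c k); rewrite /c; ring.
have : \int[mu]_(t in D) (2 * complex.Re (g t) + 0 * complex.Re (g t)) <=
    \int[mu]_(t in D) (1 * normsq (f t) + 1 * normsq (trigpoly c n t)).
  apply: le_Rintegral; first exact: measurable_circle.
  - exact: integrable_lincomb ig.1 ig.1.
  - exact: integrable_lincomb.
  - move=> t _; rewrite /g; case: (f t) (trigpoly c n t) => a b [u v] /=.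
    rewrite /normsq /= -subr_ge0.
    have := addr_ge0 (sqr_ge0 (a - u)) (sqr_ge0 (b - v)).
    by apply: etrans; congr (0 <= _); ring.
rewrite (Rintegral_lincomb _ _ ig.1 ig.1) (Rintegral_lincomb _ _ iq is_).
rewrite Rintegral_normsq_trigpoly // -/S.
have -> : \int[mu]_(t in D) complex.Re (g t) = 2 * pi * S.
  by move: cg => /(congr1 (@complex.Re R)).
by lra.
Qed.

(** When the essential infimum is infinite, any positive real number is a lower
bound. *)
Lemma ess_inf_lower_bound : (0 < ess_inf_circle phi)%E ->
  exists2 lam : R, 0 < lam & {ae mu, forall t, D t -> lam <= complex.Re (f t)}.
Proof.
move=> pos; have [lam l0 lle] : exists2 lam : R, 0 < lam &
    (lam%:E <= ess_inf_circle phi)%E.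
  case: (ess_inf_circle phi) pos => [r r0|_|//]; first by exists r.
  by exists 1 => //; rewrite leey.
exists lam => //; move: lle => /ess_infP [N [mN N0 sN]].
exists (N `&` D); split; first exact: measurableI.
  exact: N0.
move=> t /= /not_implyP [Dt h]; split => //; apply: sN => /=.
by rewrite lee_fin.
Qed.

(** The form is the mean of [f * |s|^2], with [s] the trigonometric polynomial with
coefficients [c]; as [Re f >= lam] almost everywhere, its real part is at least
[lam] times the mean of [|s|^2], which Parseval's identity computes. *)
Lemma toeplitz_form_coercive (lam : R) (I : finType) (n : I -> int)
    (c : I -> R[i]) :
  injective n -> {ae mu, forall t, D t -> lam <= complex.Re (f t)} ->
  lam * \sum_k normsq (c k) <=
  complex.Re (\sum_k \sum_l (c k)^* * fourier_coef phi (n k - n l) * c l).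
Proof.
move=> inj lle; set S := \sum_k normsq _; set Q := \sum_k _.
have pi2 : 0 < 2 * pi :> R by rewrite mulr_gt0 ?pi_gt0.
pose w t := normsq (trigpoly c n t).
have iw : mu.-integrable D (EFin \o w).
  exact: (cintegrable_normsq_trigpoly c n).1.
pose g t := f t * (w t)%:C.
have gE t : g t = \sum_(p : I * I)
    c p.1 * (c p.2)^* * (f t * cis ((n p.1 - n p.2)%:~R * t)).
  rewrite /g /w normsq_trigpoly mulr_sumr; apply: eq_bigr => p _; ring.
have [ig cg] : cintegrable g /\ cint g = (2 * pi)%:C * Q.
  rewrite (funext gE).
  have fc (p : I * I) := cintegrable_mul_cis (n p.1 - n p.2) cintegrable_symbol.
  have [? ->] :=
    cint_sum_integrable (index_enum _) (fun p => c p.1 * (c p.2)^*) fc.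
  split=> //; rewrite /Q exchange_big pair_big mulr_sumr.
  by apply: eq_bigr => p _; rewrite cint_symbol_cis opprB; ring.
pose h t := 1 * complex.Re (g t) + - lam * w t.
have ih : mu.-integrable D (EFin \o h) by exact: integrable_lincomb ig.1 iw.
(* [h] is nonnegative only almost everywhere, hence the detour through [`|h|]. *)
have h0 : 0 <= \int[mu]_(t in D) h t.
  have -> : \int[mu]_(t in D) h t = \int[mu]_(t in D) `|h t|.
    congr fine; apply: ae_eq_integral; first exact: measurable_circle.
    - exact: measurable_int ih.
    - by apply: measurable_int (integrable_norm ih).
    - apply: negligibleS lle => t ht lt; apply: ht => Dt; congr EFin.
      rewrite ger0_norm //.
      rewrite /h /g; case: (f t) (lt Dt) => a b /= la.
      rewrite mul1r mulr0 subr0 mulNr subr_ge0 ler_wpM2r //.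
      exact: normsq_ge0.
  by apply: Rintegral_ge0.
move: h0; rewrite (Rintegral_lincomb _ _ ig.1 iw).
rewrite (Rintegral_normsq_trigpoly _ inj).
have -> : \int[mu]_(t in D) complex.Re (g t) = 2 * pi * complex.Re Q.
  move: cg => /(congr1 (@complex.Re R)) /= ->.
  by case: Q => ? ?; rewrite /= mul0r subr0.
by rewrite -/S => h0; rewrite -(ler_pM2l pi2); lra.
Qed.

End Symbol.

(** * Square-summable sequences *)

Section SquareSummable.
Context {R : realType}.
Local Open Scope classical_set_scope.
Local Open Scope complex_scope.
Local Open Scope ring_scope.
Implicit Types (u v w : nat -> R[i]) (z l : R[i]).

(** In the topology of [R[i]^o] the radii of balls are elements of [R[i]]; this
criterion brings convergence back to real inequalities. *)
Lemma cvg_normsqP (x : nat -> R[i]) l :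
  (x @ \oo --> (l : R[i]^o)) <->
  (forall e : R, 0 < e -> exists N, forall n, (N <= n)%N -> normsq (l - x n) <= e).
Proof.
have le_norm (e : R) z : 0 < e -> (`|z| <= e%:C) = (normsq z <= e ^+ 2).
  move=> e0; rewrite normc_def lecR -/(normsq z).
  by rewrite -[in LHS](ger0_norm (ltW e0)) -sqrtr_sqr ler_sqrt // sqr_ge0.
split.
  move=> /(@cvgrPdist_le _ R[i]^o) xl e e0.
  have se : 0 < Num.sqrt e by rewrite sqrtr_gt0.
  have [N _ h] := xl (Num.sqrt e)%:C ltac:(by rewrite ltcR).
  by exists N => n Nn; have := h n Nn; rewrite /= le_norm // sqr_sqrtr // ltW.
move=> h; apply/(@cvgrPdist_le _ R[i]^o) => -[e i].
rewrite ltcE /= => /andP [/eqP -> e0].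
have [|N hN] := h (e ^+ 2); first by rewrite exprn_gt0.
by exists N => // n Nn /=; rewrite -/(e%:C) le_norm //; exact: hN.
Qed.

(** Induction on the sum.  Adding a term [z] to a sum [S] creates the cross term
[2 Re (z * conj S)], which the induction hypothesis and the inequality
[2 sqrt (p q) <= p + q] bound by the mixed products on the right. *)
Lemma Cauchy_Schwarz (I : Type) (s : seq I) (a b : I -> R[i]) :
  normsq (\sum_(k <- s) a k * b k) <=
  (\sum_(k <- s) normsq (a k)) * \sum_(k <- s) normsq (b k).
Proof.
elim: s => [|k s IH]; first by rewrite !big_nil mul0r /normsq /= expr0n /= addr0.
rewrite !big_cons; set S := \sum_(j <- s) a j * b j in IH *.
set A := \sum_(j <- s) _ in IH *; set B := \sum_(j <- s) _ in IH *.
have A0 : 0 <= A by apply: sumr_ge0 => j _; exact: normsq_ge0.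
have B0 : 0 <= B by apply: sumr_ge0 => j _; exact: normsq_ge0.
set z := a k * b k.
pose r := complex.Re z * complex.Re S + complex.Im z * complex.Im S.
have -> : normsq (z + S) = normsq z + normsq S + 2 * r.
  by rewrite /r; case: z S {IH r} => ? ? [? ?]; rewrite /normsq /=; ring.
have zE : normsq z = normsq (a k) * normsq (b k) by rewrite normsqM.
have al := normsq_ge0 (a k); have be := normsq_ge0 (b k).
have r2 : r ^+ 2 <= normsq z * normsq S.
  rewrite -subr_ge0 /r; case: z S {IH r zE} => x y [p q].
  have := sqr_ge0 (x * q - y * p).
  by apply: etrans; congr (0 <= _); rewrite /normsq /=; ring.
have : 2 * r <= normsq (a k) * B + A * normsq (b k).
  have p0 := mulr_ge0 al B0; have q0 := mulr_ge0 A0 be.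
  have : r ^+ 2 <= (normsq (a k) * B) * (A * normsq (b k)).
    apply: le_trans r2 _; rewrite zE.
    have : normsq (a k) * normsq (b k) * normsq S <=
      normsq (a k) * normsq (b k) * (A * B) by rewrite ler_wpM2l // mulr_ge0.
    by move/le_trans; apply; rewrite le_eqVlt; apply/orP; left; apply/eqP; ring.
  move: (normsq (a k) * B) (A * normsq (b k)) p0 q0 => p q p0 q0 rpq.
  have [r0|r0] := leP r 0; first by lra.
  rewrite -ler_sqr ?nnegrE; [|lra|lra].
  have := sqr_ge0 (p - q); nra.
by rewrite zE mulrDl !mulrDr; lra.
Qed.

Definition square_summable u : Prop :=
  exists C : R, forall N, \sum_(0 <= k < N) normsq (u k) <= C.

Lemma bounded_nneg_series_cvg (x : nat -> R) (C : R) :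
  (forall k, 0 <= x k) -> (forall N, series x N <= C) -> cvgn (series x).
Proof.
move=> x0 xC; apply: nondecreasing_is_cvgn; first exact: nondecreasing_series.
by exists C => _ [N _ <-]; exact: xC.
Qed.

Lemma square_summable_tail u (e : R) : square_summable u -> 0 < e ->
  exists N, forall m n, (N <= m <= n)%N -> \sum_(m <= k < n) normsq (u k) <= e.
Proof.
move=> [C uC] e0; pose S := series (fun k => normsq (u k)).
have u0 k : 0 <= normsq (u k) by exact: normsq_ge0.
have ndS : nondecreasing_seq S by exact: nondecreasing_series.
have cS : cvgn S by exact: (@bounded_nneg_series_cvg _ C).
have /cvgrPdist_le /(_ e e0) [N _ h] := cS.
exists N => m n /andP [Nm mn]; have := h m Nm.
have -> : \sum_(m <= k < n) normsq (u k) = S n - S m by rewrite sub_series_geq.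
have := nondecreasing_cvgn_le ndS cS n.
by rewrite /= ler_norml => + /andP [_]; lra.
Qed.

Lemma cvg_complex (x : nat -> R[i]) :
  cvgn (fun n => complex.Re (x n)) -> cvgn (fun n => complex.Im (x n)) ->
  cvgn (x : nat -> R[i]^o).
Proof.
set a := limn _ => ca; set b := limn _ => cb.
apply/cvg_ex; exists (a +i* b); apply/cvg_normsqP => e e0.
have e2 : 0 < e / 2 by rewrite divr_gt0.
have d0 : 0 < Num.sqrt (e / 2) by rewrite sqrtr_gt0.
have sq (t : R) : `|t| <= Num.sqrt (e / 2) -> t ^+ 2 <= e / 2.
  move=> ht; rewrite -[e / 2]sqr_sqrtr ?(ltW e2) // -real_normK ?num_real //.
  by rewrite ler_sqr ?nnegrE // ltW.
have /cvgrPdist_le /(_ _ d0) [N1 _ h1] := ca.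
have /cvgrPdist_le /(_ _ d0) [N2 _ h2] := cb.
exists (maxn N1 N2) => n; rewrite geq_max => /andP [n1 n2].
have := sq _ (h1 n n1); have := sq _ (h2 n n2).
rewrite /a /b /normsq /=; case: (x n) => p q /=; lra.
Qed.

Lemma Re_sum (I : Type) (s : seq I) (P : pred I) (F : I -> R[i]) :
  complex.Re (\sum_(k <- s | P k) F k) = \sum_(k <- s | P k) complex.Re (F k).
Proof. by elim/big_rec2: _ => [|k y z _ <-] //=; case: (F k) z => ? ? []. Qed.

Lemma Im_sum (I : Type) (s : seq I) (P : pred I) (F : I -> R[i]) :
  complex.Im (\sum_(k <- s | P k) F k) = \sum_(k <- s | P k) complex.Im (F k).
Proof. by elim/big_rec2: _ => [|k y z _ <-] //=; case: (F k) z => ? ? []. Qed.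

(** The real and imaginary parts of a product [z * l] are at most
[|z|^2 + |l|^2] in absolute value, so both series converge absolutely. *)
Lemma square_summable_mul_cvg u v : square_summable u -> square_summable v ->
  cvgn (series (fun k => u k * v k : R[i]^o)).
Proof.
move=> [C uC] [K vK].
have key (p : R[i] -> R) : (forall z l, `|p (z * l)| <= normsq z + normsq l) ->
    cvgn (series (fun k => p (u k * v k))).
  move=> hp; apply: normed_cvg.
  apply: (@bounded_nneg_series_cvg _ (C + K)) => N; first exact: normr_ge0.
  apply: (le_trans _ (lerD (uC N) (vK N))); rewrite -big_split /=.
  by apply: ler_sum => k _; exact: hp.
have young (a b c d : R) : a * c + b * d <= a ^+ 2 + b ^+ 2 + (c ^+ 2 + d ^+ 2).
  have := sqr_ge0 (a - c); have := sqr_ge0 (b - d).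
  by have := sqr_ge0 (a + c); have := sqr_ge0 (b + d); nra.
apply: cvg_complex; rewrite /series /=.
  under [X in cvgn X]funext do rewrite Re_sum.
  apply: key => -[a b] [c d]; rewrite /normsq /= ler_norml; apply/andP; split.
    have := young a b (- c) d; rewrite sqrrN; lra.
  have := young a b c (- d); rewrite sqrrN; lra.
under [X in cvgn X]funext do rewrite Im_sum.
apply: key => -[a b] [c d]; rewrite /normsq /= ler_norml; apply/andP; split.
  have := young a b (- d) (- c); rewrite !sqrrN; lra.
have := young a b d c; lra.
Qed.

Lemma sum_normsq_small (V : nat -> nat -> R[i]) v m (e : R) :
  (forall k, V ^~ k @ \oo --> (v k : R[i]^o)) -> 0 < e ->
  exists N, forall n, (N <= n)%N -> \sum_(0 <= k < m) normsq (v k - V n k) <= e.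
Proof.
move=> Vv; elim: m e => [|m IH] e e0.
  by exists 0%N => n _; rewrite big_nil ltW.
have e2 : 0 < e / 2 by rewrite divr_gt0.
have [N1 h1] := IH _ e2; have /cvg_normsqP /(_ _ e2) [N2 h2] := Vv m.
exists (maxn N1 N2) => n; rewrite geq_max => /andP [n1 n2].
by rewrite big_nat_recr //=; have := h1 n n1; have := h2 n n2; lra.
Qed.

(** A bounded sequence of [l^2] that converges entrywise converges weakly, so its
pairing with [u] passes to the limit.  Concretely, [d] minus a partial sum up to
[m] is a tail [\sum_(m <= k < n) u k * V n k], small uniformly in [n] because
[u] is square-summable, plus a sum of [m] terms containing [v k - V n k], which
vanishes as [n] grows with [m] fixed. *)
Lemma weak_limit_series u v (V : nat -> nat -> R[i]) (K : R) (d : R[i]) N0 :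
  square_summable u ->
  (forall n, \sum_(0 <= k < n) normsq (V n k) <= K) ->
  (forall k, V ^~ k @ \oo --> (v k : R[i]^o)) ->
  (forall n, (N0 <= n)%N -> \sum_(0 <= k < n) u k * V n k = d) ->
  series (fun k => u k * v k) @ \oo --> (d : R[i]^o).
Proof.
move=> su VK Vv Vd; have [C uC] := su.
have K0 : 0 <= K by have := VK 0%N; rewrite big_nil.
have C0 : 0 <= C by have := uC 0%N; rewrite big_nil.
apply/cvg_normsqP => e e0.
(* [normsqD_le] doubles the two contributions, which are therefore made at most
   [e / 4] each; [K] and [C] may be zero, hence the denominators [K + 1] and
   [C + 1]. *)
have eK : 0 < e / (4 * (K + 1)) by rewrite divr_gt0 // mulr_gt0 // ltr_wpDl.
have eC : 0 < e / (4 * (C + 1)) by rewrite divr_gt0 // mulr_gt0 // ltr_wpDl.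
have [m0 tail] := square_summable_tail su eK.
exists m0 => m m0m.
have [N1 small] := sum_normsq_small m Vv eC.
pose n := maxn (maxn N0 N1) m.
have [n0 n1 mn] : [/\ (N0 <= n)%N, (N1 <= n)%N & (m <= n)%N].
  by rewrite /n !leq_max !leqnn !orbT.
rewrite -(Vd n n0) (@big_cat_nat _ _ _ m) //= /series /=.
set T := \sum_(m <= i < n) _.
have -> : \sum_(0 <= i < m) u i * V n i + T - \sum_(0 <= k < m) u k * v k =
    T + - (\sum_(0 <= k < m) u k * (v k - V n k)).
  rewrite addrAC addrC -sumrB -sumrN; congr (_ + _).
  by apply: eq_bigr => k _; ring.
apply: le_trans (normsqD_le _ _) _.
have hT : normsq T <= e / 4.
  apply: le_trans (Cauchy_Schwarz _ _ _) _.
  have -> : e / 4 = e / (4 * (K + 1)) * (K + 1).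
    by field; rewrite gt_eqF // ltr_wpDl.
  apply: ler_pM; try by apply: sumr_ge0 => *; exact: normsq_ge0.
    by apply: tail; rewrite m0m.
  apply: le_trans (_ : K <= _); last by rewrite lerDl.
  apply: (le_trans _ (VK n)); rewrite [leRHS](@big_cat_nat _ _ _ m) //= lerDr.
  by apply: sumr_ge0 => *; exact: normsq_ge0.
have hS : normsq (- \sum_(0 <= k < m) u k * (v k - V n k)) <= e / 4.
  rewrite /normsq; set z := \sum_(0 <= k < m) _.
  have -> : complex.Re (- z) ^+ 2 + complex.Im (- z) ^+ 2 = normsq z.
    by case: z => ? ?; rewrite /normsq /= !sqrrN.
  apply: le_trans (Cauchy_Schwarz _ _ _) _.
  have -> : e / 4 = (C + 1) * (e / (4 * (C + 1))).
    by field; rewrite gt_eqF // ltr_wpDl.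
  apply: ler_pM; try by apply: sumr_ge0 => *; exact: normsq_ge0.
    by apply: le_trans (uC m) _; rewrite lerDl.
  exact: small.
lra.
Qed.

End SquareSummable.

(** * Finite sections and their inverses *)

Section FiniteSections.
Context {R : realType}.
Local Open Scope classical_set_scope.
Local Open Scope complex_scope.
Local Open Scope ring_scope.
Variables (T B : infmx R).
Hypothesis TB : is_transition_matrix T B.

Lemma transition_upper k n : (n < k)%N -> B k n = 0.
Proof.
have [P [sP _ _] BP] := TB => nk.
by rewrite BP nth_default // (leq_trans (sP n)).
Qed.

Lemma sum_ord_pad (m N : nat) (F : nat -> R[i]) : (m <= N)%N ->
  (forall k, (m <= k)%N -> F k = 0) -> \sum_(k < m) F k = \sum_(k < N) F k.
Proof.
move=> mN F0; rewrite -!(big_mkord xpredT) (@big_cat_nat _ _ _ m 0 N) //=.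
rewrite [X in _ = _ + X]big_nat [X in _ = _ + X]big1 ?addr0 // => k /andP [mk _].
exact: F0.
Qed.

(** The sums that define the form stop at the sizes of the polynomials; padding
them with zeros gives all polynomials of index below [N] the same range. *)
Lemma transition_orthonormal N n m : (n < N)%N -> (m < N)%N ->
  \sum_(i < N) \sum_(j < N) B i n * T i j * (B j m)^* = (n == m)%:R.
Proof.
have [P [sP _ oP] BP] := TB => nN mN.
rewrite -oP /poly_form [RHS](@sum_ord_pad _ N
  (fun i => \sum_(j < size (P m)) (P n)`_i * ((P m)`_j)^* * T i j)).
- apply: eq_bigr => i _; rewrite [RHS](@sum_ord_pad _ N
    (fun j => (P n)`_i * ((P m)`_j)^* * T i j)).
  + by apply: eq_bigr => j _; rewrite !BP mulrAC.
  + exact: leq_trans (sP m) _.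
  + by move=> k mk; rewrite (nth_default _ mk) rmorph0 mulr0 mul0r.
- exact: leq_trans (sP n) _.
- by move=> k nk; rewrite big1 // => j _; rewrite (nth_default _ nk) !mul0r.
Qed.

(** The [(i, j)] entry of [conj B * B^t] for the [N]-th sections of [B]; for
[i, j < N] this is the inverse of the [N]-th section of [T].  As a function of
[N] it is also the sequence of partial sums of the [(i, j)] entry of the
infinite product. *)
Definition partial_inverse (N i j : nat) : R[i] :=
  \sum_(0 <= k < N) (B i k)^* * B j k.
Local Notation A := partial_inverse.

Lemma partial_inverse_herm N i j : A N i j = (A N j i)^*.
Proof.
rewrite rmorph_sum; apply: eq_bigr => k _.
by rewrite rmorphM /= conjCK mulrC.
Qed.

Let Tn N : 'M[R[i]]_N := \matrix_(i < N, j < N) T i j.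
Let Bn N : 'M[R[i]]_N := \matrix_(i < N, j < N) B i j.
Let Bc N : 'M[R[i]]_N := \matrix_(i < N, j < N) (B i j)^*.
Let An N : 'M[R[i]]_N := \matrix_(i < N, j < N) A N i j.

Let AnE N : An N = Bc N *m (Bn N)^T.
Proof.
apply/matrixP => i j; rewrite !mxE /A big_mkord.
by apply: eq_bigr => k _; rewrite !mxE.
Qed.

(* Orthonormality, written with matrices.  As a one-sided inverse of a square
   matrix is two-sided, the factors may be permuted cyclically. *)
Let orthoE N : (Bn N)^T *m (Tn N *m Bc N) = 1%:M.
Proof.
apply/matrixP => n m; rewrite !mxE.
rewrite -[RHS](transition_orthonormal (ltn_ord n) (ltn_ord m)).
apply: eq_bigr => i _; rewrite !mxE mulr_sumr.
by apply: eq_bigr => j _; rewrite !mxE mulrA.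
Qed.

Lemma section_mul_partial_inverse N i j : (i < N)%N -> (j < N)%N ->
  \sum_(0 <= k < N) T i k * A N k j = (i == j)%:R.
Proof.
move=> iN jN; have := mulmx1C (orthoE N); rewrite -mulmxA -AnE.
move=> /matrixP /(_ (Ordinal iN) (Ordinal jN)); rewrite !mxE => <-.
by rewrite big_mkord; apply: eq_bigr => k _; rewrite !mxE.
Qed.

Lemma partial_inverse_mul_section N i j : (i < N)%N -> (j < N)%N ->
  \sum_(0 <= k < N) A N i k * T k j = (i == j)%:R.
Proof.
move=> iN jN; have := orthoE N; rewrite mulmxA => /mulmx1C; rewrite mulmxA -AnE.
move=> /matrixP /(_ (Ordinal iN) (Ordinal jN)); rewrite !mxE => <-.
by rewrite big_mkord; apply: eq_bigr => k _; rewrite !mxE.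
Qed.

Variable lam : R.
Hypothesis lam_gt0 : 0 < lam.
Hypothesis coercive : forall (N : nat) (y : nat -> R[i]),
  lam * \sum_(0 <= k < N) normsq (y k) <=
  complex.Re (\sum_(0 <= k < N) \sum_(0 <= l < N) (y k)^* * T k l * y l).

Lemma partial_inverse_diag N j : A N j j = (\sum_(0 <= k < N) normsq (B j k))%:C.
Proof.
rewrite rmorph_sum; apply: eq_bigr => k _.
by have /= -> := normsqE (B j k); rewrite mulrC.
Qed.

(** The column [y] of index [j] of the inverse section solves [T y = e_j], so that
coercivity gives [lam * |y|^2 <= y_j].  Here [y_j] is the squared norm [a] of
the first [N] entries of row [j] of [B], and [a ^+ 2 <= |y|^2]; both bounds
follow from [lam * a ^+ 2 <= lam * |y|^2 <= a]. *)
Lemma partial_inverse_bounds N j :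
  \sum_(0 <= k < N) normsq (B j k) <= lam^-1 /\
  \sum_(0 <= k < N) normsq (A N k j) <= lam^-1 ^+ 2.
Proof.
set a := \sum_(0 <= k < N) normsq (B j k); set S := \sum_(0 <= k < N) _.
have a0 : 0 <= a by apply: sumr_ge0 => *; exact: normsq_ge0.
have l0 : 0 <= lam^-1 by rewrite invr_ge0 ltW.
(* If [N <= j], row [j] of [B] has not reached the diagonal yet. *)
have [jN|Nj] := ltnP j N; last first.
  have Bj0 k : (k < N)%N -> B j k = 0 by
    move=> kN; apply: transition_upper; exact: leq_trans Nj.
  have n0 : normsq (0 : R[i]) = 0 by rewrite /normsq /= expr0n /= addr0.
  have -> : a = 0 by rewrite /a big_nat big1 // => k /andP [_ kN]; rewrite Bj0.
  have -> : S = 0.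
    rewrite /S big1 // => k _; rewrite /A big_nat big1 // => i /andP [_ iN].
    by rewrite Bj0 // mulr0.
  by rewrite exprn_ge0.
have aS : a ^+ 2 <= S.
  rewrite /S big_mkord (bigD1 (Ordinal jN)) //= partial_inverse_diag -/a.
  rewrite {1}/normsq /= expr0n /= addr0 lerDl.
  by apply: sumr_ge0 => *; exact: normsq_ge0.
have laS : lam * S <= a.
  apply: le_trans (coercive N (fun k => A N k j)) _.
  have -> : \sum_(0 <= k < N) \sum_(0 <= l < N) (A N k j)^* * T k l * A N l j =
      A N j j.
    transitivity (\sum_(0 <= k < N) (A N k j)^* * (k == j)%:R).
      apply: eq_big_nat => k /andP [_ kN].
      rewrite -(section_mul_partial_inverse kN jN) mulr_sumr.
      by apply: eq_bigr => l _; rewrite mulrA.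
    rewrite big_mkord (bigD1 (Ordinal jN)) //= eqxx mulr1 -partial_inverse_herm.
    rewrite big1 ?addr0 // => k kj; rewrite -val_eqE /= in kj.
    by rewrite (negbTE kj) mulr0.
  by rewrite partial_inverse_diag.
have al : a <= lam^-1.
  have [->//|an0] := eqVneq a 0.
  have a_gt0 : 0 < a by rewrite lt0r an0.
  rewrite -(ler_pM2l lam_gt0) divff ?gt_eqF // -(ler_pM2r a_gt0) mul1r.
  by apply: le_trans laS; rewrite -mulrA ler_pM2l.
split => //; rewrite -(ler_pM2l lam_gt0); apply: le_trans laS _.
by rewrite expr2 mulrA divff ?gt_eqF // mul1r.
Qed.

Hypothesis rows : forall i, square_summable (T i).
Hypothesis cols : forall j, square_summable (T^~ j).

(** The columns of the inverse sections are bounded in [l^2] and converge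
entrywise to those of [conj B * B^t], and the sections are eventually exact
inverses at each entry; as rows and columns of [T] are square-summable, both
products pass to the limit. *)
Theorem transition_inverse :
  infmx_mul_exists (infmx_conj B) (infmx_tr B) /\
  classical_inverse T (infmx_mul (infmx_conj B) (infmx_tr B)).
Proof.
have sB j : square_summable (B j).
  by exists lam^-1 => N; exact: (partial_inverse_bounds N j).1.
have sBc j : square_summable (fun k => (B j k)^*).
  have [C h] := sB j; exists C => N.
  by apply: le_trans (h N); apply: ler_sum => k _; rewrite normsqJ.
have AB : infmx_mul_exists (infmx_conj B) (infmx_tr B).
  by move=> i j; exact: (square_summable_mul_cvg (sBc i) (sB j)).
set Ainf := infmx_mul _ _.
have cA i j : (fun N => A N i j) @ \oo --> (Ainf i j : R[i]^o) by exact: (AB i j).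
have TA i j : infmx_mul_series T Ainf i j @ \oo --> (infmx_id R i j : R[i]^o).
  apply: (@weak_limit_series _ (T i) (Ainf^~ j) (fun N k => A N k j)
    (lam^-1 ^+ 2) _ (maxn i j).+1) => //.
  - by move=> n; exact: (partial_inverse_bounds n j).2.
  - move=> n; rewrite gtn_max => /andP [? ?].
    exact: section_mul_partial_inverse.
have AT i j : infmx_mul_series Ainf T i j @ \oo --> (infmx_id R i j : R[i]^o).
  have -> : infmx_mul_series Ainf T i j = series (fun k => T k j * Ainf i k).
    by congr series; apply/funext => k; rewrite mulrC.
  apply: (@weak_limit_series _ (T^~ j) (Ainf i) (fun N k => A N i k)
    (lam^-1 ^+ 2) _ (maxn i j).+1) => //.
  - move=> n; apply: le_trans (partial_inverse_bounds n i).2.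
    by apply: ler_sum => k _; rewrite partial_inverse_herm normsqJ.
  - move=> n; rewrite gtn_max => /andP [ni nj].
    rewrite -[RHS](partial_inverse_mul_section ni nj).
    by apply: eq_bigr => k _; rewrite mulrC.
split; first exact: AB.
have lim_id (M N : infmx R) :
    (forall i j, infmx_mul_series M N i j @ \oo --> (infmx_id R i j : R[i]^o)) ->
    infmx_mul_exists M N /\ infmx_mul M N =2 @infmx_id R.
  move=> MN; split=> i j; first by apply: cvgP (MN i j).
  by apply: (@cvg_lim R[i]^o) (MN i j); exact: norm_hausdorff.
have [? ?] := lim_id _ _ TA; have [? ?] := lim_id _ _ AT.
by split.
Qed.

End FiniteSections.

(** * The classical inverse of a Toeplitz matrix *)

Local Open Scope ereal_scope.

Theorem proposition2 (R : realType) (phi : R[i] -> R[i]) (B : infmx R) :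
  L2_circle phi ->
  0 < ess_inf_circle phi ->
  HPD (toeplitz phi) ->
  is_transition_matrix (toeplitz phi) B ->
  infmx_mul_exists (infmx_conj B) (infmx_tr B) /\
  classical_inverse (toeplitz phi) (infmx_mul (infmx_conj B) (infmx_tr B)).
Proof.
move=> L2 pos _ TB; have [lam lam0 lle] := ess_inf_lower_bound pos.
apply: (transition_inverse TB lam0).
- move=> N y.
  have := @toeplitz_form_coercive _ _ L2 lam 'I_N
    (fun k => Posz k) (fun k => y k).
  rewrite !big_mkord => /(_ _ lle) h; apply: le_trans (h _) _.
    by move=> k l [] /val_inj.
  rewrite le_eqVlt; apply/orP; left; apply/eqP; congr complex.Re.
  by apply: eq_bigr => k _; rewrite big_mkord.
- move=> i; eexists=> N; rewrite big_mkord.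
  apply: (Bessel L2 (n := fun k : 'I_N => (i%:Z - k%:Z)%R)) => k l.
  by move=> /addrI /oppr_inj [] /val_inj.
- move=> j; eexists=> N; rewrite big_mkord.
  apply: (Bessel L2 (n := fun k : 'I_N => (k%:Z - j%:Z)%R)) => k l.
  by move=> /addIr [] /val_inj.
Qed.
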